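(* Let $r$, $k$, $p$, $v$ and $w$ be positive integers with $r \ge k > p$. Let $a, b, m$ be the unique integers with $v = \binom{a}{k}_r + \binom{b}{k-1}_{r-1} + m$, $a - \lfloor a/r\rfloor > b$ and $\binom{b - \lfloor b/(r-1)\rfloor}{k-2}_{r-2} > m \ge 0$. If $$w \ge \binom{a}{p}_r + \binom{b}{p-1}_{r-1} + d_{p,r}^k(m),$$ then the construction described below (with targets $v$ and $w$) does not fail and gives a flag complex $\Delta$ of dimension at most $r-1$ with $f_{k-1}(\Delta) = v$ and $f_{p-1}(\Delta) = w$.
   Context: A flag complex is the clique complex of a graph (faces = vertex sets of cliques); $f_{i-1}(\Delta)$ is the number of faces with $i$ vertices, and the dimension is one less than the maximum face size. The Turán graph $T_{n,r}$ partitions $n$ vertices into $r$ parts as evenly as possible, with two vertices adjacent exactly when in different parts; $\binom{n}{k}_r$ is the number of $k$-vertex cliques of $T_{n,r}$. For $m > 0$, $j_k^r(m)$ is the unique integer with $\binom{j_k^r(m)}{k-1}_{r-1} \le m < \binom{j_k^r(m)+1}{k-1}_{r-1}$, and $d_{p,r}^k(0) = 0$, $d_{p,r}^k(m) = \binom{j_k^r(m)}{p-1}_{r-1} + d_{p,r}^k\!\left(m - \binom{j_k^r(m)}{k-1}_{r-1}\right)$ for $m > 0$. The construction: let $n_0$ be the unique integer with $\binom{n_0}{k}_r \le v < \binom{n_0+1}{k}_r$, $m_0 = v - \binom{n_0}{k}_r$. For $i \ge 1$: if $m_{i-1}=0$ set $z = i-1$ and stop; else let $n_i$ be the unique integer with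 $\binom{n_i}{k-1}_{r-1} \le m_{i-1} < \binom{n_i+1}{k-1}_{r-1}$ and $m_i = m_{i-1} - \binom{n_i}{k-1}_{r-1}$. Take the graph consisting of $T_{n_0,r}$ together with new vertices $v_1,\dots,v_z$, where the neighbourhood of $v_i$ is a vertex set of $T_{n_0,r}$ inducing a copy of $T_{n_i,r-1}$ (and $v_i$ has no other neighbours); let $\Delta$ be its clique complex. If $f_{p-1}(\Delta) > w$ the construction fails; otherwise add $w - f_{p-1}(\Delta)$ new vertices, each adjacent to exactly $p-1$ pairwise adjacent vertices of the original $T_{n_0,r}$, and take the clique complex. *)

(* Defs.v *)
From Stdlib Require Import ClassicalEpsilon.
From mathcomp Require Import all_boot all_order all_algebra.

Set Implicit Arguments.
Unset Strict Implicit.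
Unset Printing Implicit Defensive.

Record sgraph (T : finType) := SGraph {
  adj :> rel T;
  adj_sym : symmetric adj;
  adj_irrefl : irreflexive adj }.

Definition clique (T : finType) (G : sgraph T) (s : {set T}) : bool :=
  [forall x in s, forall y in s, (x != y) ==> G x y].

Definition clique_complex (T : finType) (G : sgraph T) : {set {set T}} :=
  [set s | clique G s].

Definition is_flag_complex (T : finType) (D : {set {set T}}) : Prop :=
  exists G : sgraph T, D = clique_complex G.

(* The index is the number of vertices: [nfaces D i] is f_(i-1)(D). *)
Definition nfaces (T : finType) (D : {set {set T}}) (i : nat) : nat :=
  #|[set s in D | #|s| == i]|.

Definition cdim (T : finType) (D : {set {set T}}) : int :=
  ((\max_(s in D) #|s|)%:Z - 1)%R.

(* The r parts are the residue classes mod r, whose sizes in {0, ..., n-1}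
   differ by at most 1.  With r = 0 parts only n = 0 is meaningful. *)
Definition turan_rel (n r : nat) : rel 'I_n := fun x y => x != y %[mod r].

Lemma turan_sym n r : symmetric (@turan_rel n r).
Proof. by move=> x y; rewrite /turan_rel eq_sym. Qed.

Lemma turan_irrefl n r : irreflexive (@turan_rel n r).
Proof. by move=> x; rewrite /turan_rel eqxx. Qed.

Definition turan (n r : nat) : sgraph 'I_n :=
  SGraph (@turan_sym n r) (@turan_irrefl n r).

(* The Turan binomial coefficient: n over k, with subscript r. *)
Definition tbin (n k r : nat) : nat := nfaces (clique_complex (turan n r)) k.

Lemma tbin_mono k r : {homo (fun n => tbin n k r) : x y / x <= y}.
Proof.
move=> n n' le_nn'; rewrite /tbin /nfaces.
pose h (S : {set 'I_n}) := widen_ord le_nn' @: S.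
have w_inj : injective (widen_ord le_nn').
  by move=> x y /(congr1 val) /= xy; apply: val_inj.
have h_inj : injective h by apply: imset_inj.
rewrite -(card_imset _ h_inj); apply: subset_leq_card; apply/subsetP => _
  /imsetP[S + ->]; rewrite !inE /h card_imset // => /andP[/forall_inP cS ->].
rewrite andbT; apply/forall_inP => _ /imsetP[x xS ->].
apply/forall_inP => _ /imsetP[y yS ->]; apply/implyP => nxy.
have /forall_inP/(_ y yS)/implyP := cS _ xS; apply.
by apply: contraNneq nxy => ->.
Qed.

Lemma tbin_small n k r : n < k -> tbin n k r = 0.
Proof.
move=> lt_nk; apply/eqP; rewrite cards_eq0; apply/eqP/setP => S; rewrite !inE.
apply: contraTF lt_nk => /andP[_ /eqP <-]; rewrite -leqNgt.
by rewrite -[leqRHS]card_ord max_card.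
Qed.

Lemma tbin_diag k r : tbin k k r <= 1.
Proof.
rewrite -(cards1 [set: 'I_k]); apply: subset_leq_card; apply/subsetP => S.
rewrite !inE => /andP[_ /eqP cS]; rewrite eqEcard subsetT /= cardsT card_ord.
by rewrite cS.
Qed.

Lemma tbin_unbounded k r m : 0 < k <= r -> m < tbin (k + m * r) k r.
Proof.
move=> /andP[k_gt0 le_kr]; have r_gt0 := leq_trans k_gt0 le_kr.
set n := k + m * r.
pose g (i : 'I_m.+1) (j : nat) := if j == k.-1 then k.-1 + i * r else j.
have gn i (j : 'I_k) : g i j < n.
  rewrite /g /n; case: ifP => _.
    by rewrite -addSn prednK // leq_add2l leq_mul2r -ltnS ltn_ord orbT.
  by rewrite ltn_addr.
have gmod i (j : 'I_k) : g i j %% r = j.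
  rewrite /g; case: eqP => [e|_].
    by rewrite addnC modnMDl -e modn_small // (leq_trans (ltn_ord j)).
  by rewrite modn_small // (leq_trans (ltn_ord j)).
pose G i j := Ordinal (gn i j).
have G_inj i : injective (G i).
  by move=> j j' /(congr1 (fun x : 'I_n => x %% r)) /=; rewrite !gmod => /val_inj.
pose S i := G i @: [set: 'I_k].
have S_inj : injective S.
  move=> i i' eS; have lk : k.-1 < k by rewrite prednK.
  have : G i (Ordinal lk) \in S i' by rewrite -eS imset_f.
  case/imsetP => j _ /(congr1 val) /= e.
  have ej : j = k.-1 :> nat by rewrite -(gmod i' j) -e (gmod i (Ordinal lk)).
  move: e; rewrite /g /= ej eqxx => /addnI /eqP.
  by rewrite eqn_pmul2r // => /eqP/val_inj.
rewrite -[m.+1]card_ord -cardsT -(card_imset _ S_inj).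
apply: subset_leq_card; apply/subsetP => _ /imsetP[i _ ->].
rewrite !inE (card_imset _ (G_inj i)) cardsT card_ord eqxx andbT.
apply/forall_inP => _ /imsetP[x _ ->]; apply/forall_inP => _ /imsetP[y _ ->].
by apply/implyP; rewrite /= /turan_rel /= !gmod; apply: contraNneq => /val_inj ->.
Qed.

(* The n with tbin n k r <= m < tbin n.+1 k r; see [tindex_exists_unique]. *)
Definition tindex (k r m : nat) : nat :=
  epsilon (inhabits 0) (fun n => tbin n k r <= m < tbin n.+1 k r).

Lemma tindex_exists_unique k r m : 0 < k <= r ->
  exists! n, tbin n k r <= m < tbin n.+1 k r.
Proof.
move=> kr; have [k_gt0 _] := andP kr.
have ex : exists n, m < tbin n.+1 k r.
  exists (k + m * r).-1; rewrite prednK ?addn_gt0 ?k_gt0 //.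
  exact: tbin_unbounded.
case: (ex_minnP ex) => n ltn minn; exists n; split.
  rewrite ltn andbT; case: n ltn minn => [|n] _ minn; first by rewrite tbin_small.
  by rewrite leqNgt; apply/negP => /minn; rewrite ltnn.
move=> n' /andP[len' ltn']; apply/eqP; rewrite eqn_leq minn //= leqNgt.
by apply/negP => /(tbin_mono k r) /(leq_trans ltn); rewrite ltnNge len'.
Qed.

Lemma tindexP k r m : 0 < k <= r ->
  tbin (tindex k r m) k r <= m < tbin (tindex k r m).+1 k r.
Proof.
move=> /(tindex_exists_unique m)[n [nP _]].
exact: (epsilon_spec (inhabits 0) (fun n => tbin n k r <= m < tbin n.+1 k r)
  (ex_intro _ n nP)).
Qed.

Definition jidx (k r m : nat) : nat := tindex k.-1 r.-1 m.

(* [n] is fuel: the argument [m] drops at every step, so [n = m] suffices;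
   see [dnum_rec]. *)
Fixpoint dnum_fuel (p r k n m : nat) : nat :=
  if n is n'.+1 then
    if m == 0 then 0
    else tbin (jidx k r m) p.-1 r.-1
         + dnum_fuel p r k n' (m - tbin (jidx k r m) k.-1 r.-1)
  else 0.

Definition dnum (p r k m : nat) : nat := dnum_fuel p r k m m.

Lemma dnum0 p r k : dnum p r k 0 = 0.
Proof. by []. Qed.

Lemma dnum_rec p r k m : 1 < k <= r -> 0 < m ->
  dnum p r k m = tbin (jidx k r m) p.-1 r.-1
                 + dnum p r k (m - tbin (jidx k r m) k.-1 r.-1).
Proof.
move=> /andP[k_gt1 le_kr].
have kr : 0 < k.-1 <= r.-1.
  by rewrite -ltnS prednK ?k_gt1 ?(ltnW k_gt1) //= -!subn1 leq_sub2r.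
have drop x : 0 < x -> x - tbin (jidx k r x) k.-1 r.-1 < x.
  move=> x_gt0; rewrite -subn_gt0 subKn; last by case/andP: (tindexP x kr).
  have /andP[_ lt_x] := tindexP x kr; rewrite lt0n; apply/eqP => t0.
  have [lt_jk|le_kj] := ltnP (tindex k.-1 r.-1 x) k.-1.
    have := leq_trans lt_x (leq_trans (tbin_mono k.-1 r.-1 lt_jk) (tbin_diag _ _)).
    by rewrite ltnS leqNgt x_gt0.
  have := tbin_unbounded 0 kr; rewrite mul0n addn0 => /leq_trans.
  by move=> /(_ _ (tbin_mono k.-1 r.-1 le_kj)); rewrite -[tindex _ _ _]/(jidx k r x) t0.
have stable n1 n2 x : x <= n1 -> x <= n2 ->
    dnum_fuel p r k n1 x = dnum_fuel p r k n2 x.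
  elim: n1 n2 x => [|n1 IH] [|n2] [|x] //= le1 le2; congr (_ + _).
  by apply: IH; rewrite -ltnS (leq_trans (drop _ _)).
case: m => // m _; rewrite {1}/dnum /=; congr (_ + _); apply: stable => //.
by rewrite -ltnS drop.
Qed.

Definition n_zero (k r v : nat) : nat := tindex k r v.

Fixpoint m_seq (k r v i : nat) : nat :=
  if i is i'.+1
  then m_seq k r v i' - tbin (jidx k r (m_seq k r v i')) k.-1 r.-1
  else v - tbin (n_zero k r v) k r.

(* [n_seq k r v i] is n_(i+1), the index attached to the vertex v_(i+1). *)
Definition n_seq (k r v i : nat) : nat := jidx k r (m_seq k r v i).

Definition stops_at (k r v z : nat) : Prop :=
  m_seq k r v z = 0 /\ forall i, i < z -> 0 < m_seq k r v i.

(* Adjoin to G pairwise non-adjacent new vertices indexed by I, the new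
   vertex i having neighbourhood N i in G. *)
Definition attach_rel (T I : finType) (G : sgraph T) (N : I -> {set T}) :
    rel (T + I)%type :=
  fun x y => match x, y with
  | inl t, inl u => G t u
  | inl t, inr i => t \in N i
  | inr i, inl t => t \in N i
  | inr _, inr _ => false
  end.

Lemma attach_sym (T I : finType) (G : sgraph T) (N : I -> {set T}) :
  symmetric (attach_rel G N).
Proof. by move=> [t|i] [u|j] //=; apply: adj_sym. Qed.

Lemma attach_irrefl (T I : finType) (G : sgraph T) (N : I -> {set T}) :
  irreflexive (attach_rel G N).
Proof. by move=> [t|i] //=; apply: adj_irrefl. Qed.

Definition attach (T I : finType) (G : sgraph T) (N : I -> {set T}) :
    sgraph (T + I)%type :=
  SGraph (attach_sym G N) (attach_irrefl G N).

Definition induces_copy (T U : finType) (G : sgraph T) (S : {set T})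
    (H : sgraph U) : Prop :=
  exists f : U -> T,
    [/\ injective f, f @: [set: U] = S & forall x y, G (f x) (f y) = H x y].

Definition first_choice (k r v z : nat)
    (N : 'I_z -> {set 'I_(n_zero k r v)}) : Prop :=
  forall i : 'I_z,
    induces_copy (turan (n_zero k r v) r) (N i) (turan (n_seq k r v i) r.-1).

Definition first_graph (k r v z : nat)
    (N : 'I_z -> {set 'I_(n_zero k r v)}) :
    sgraph ('I_(n_zero k r v) + 'I_z)%type :=
  attach (turan (n_zero k r v) r) N.

Definition second_choice (k r p v q : nat)
    (M : 'I_q -> {set 'I_(n_zero k r v)}) : Prop :=
  forall i : 'I_q, clique (turan (n_zero k r v) r) (M i) /\ #|M i| = p.-1.

Definition final_graph (k r v z q : nat)
    (N : 'I_z -> {set 'I_(n_zero k r v)})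
    (M : 'I_q -> {set 'I_(n_zero k r v)}) :
    sgraph ('I_(n_zero k r v) + 'I_z + 'I_q)%type :=
  attach (first_graph N) (fun i => inl @: M i).

(* Main.v *)
(* Ordering the vertices so that 0 is deleted first gives the Pascal recurrence
   [n+1, k+1]_(r+1) = [n, k+1]_(r+1) + [n - n/(r+1), k]_r for the Turan
   binomials [n, k]_r = tbin n k r.  It turns the two inequalities on a, b and m
   into the defining inequalities of n_0 and n_1, so that n_0 = a and, unless
   the construction stops at once, n_1 = b and m_1 = m.  Each adjoined vertex v_i
   contributes the j-faces of a Turan graph on n_i vertices to the (j+1)-faces,
   whence f_(k-1) = v and f_(p-1) = [a, p]_r + d(m_0) <= w after the first stage.
   A vertex of the second stage is joined to a (p-1)-clique: it adds one p-clique
   and no larger one. *)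
Require Import Defs.
From mathcomp Require Import all_boot all_order all_algebra zify.

Set Implicit Arguments.
Unset Strict Implicit.
Unset Printing Implicit Defensive.

(** * Cliques inside a vertex set and induced copies *)

Definition cliques_in (T : finType) (G : sgraph T) (A : {set T}) (k : nat) :
    {set {set T}} :=
  [set s | [&& clique G s, #|s| == k & s \subset A]].

Lemma clique_imset (T U : finType) (G : sgraph T) (H : sgraph U) (f : U -> T)
    (s : {set U}) :
  injective f -> (forall x y, G (f x) (f y) = H x y) ->
  clique G (f @: s) = clique H s.
Proof.
move=> f_inj fE; apply/forall_inP/forall_inP => [cS x xs|cS _ /imsetP[x xs ->]].
  apply/forall_inP => y ys; have /forall_inP := cS _ (imset_f f xs).
  by move=> /(_ _ (imset_f f ys)); rewrite (inj_eq f_inj) fE.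
apply/forall_inP => _ /imsetP[y ys ->]; rewrite (inj_eq f_inj) fE.
by have /forall_inP := cS _ xs; apply.
Qed.

Lemma sub_clique (T : finType) (G : sgraph T) (s t : {set T}) :
  s \subset t -> clique G t -> clique G s.
Proof.
move=> /subsetP st /forall_inP ct; apply/forall_inP => x xs.
by apply/forall_inP => y ys; have /forall_inP := ct _ (st _ xs); apply; apply: st.
Qed.

Lemma card_cliques_in_copy (T U : finType) (G : sgraph T) (S : {set T})
    (H : sgraph U) (k : nat) :
  induces_copy G S H -> #|cliques_in G S k| = nfaces (clique_complex H) k.
Proof.
case=> f [f_inj <- fE]; rewrite /nfaces -(card_imset _ (imset_inj f_inj)).
congr #|pred_of_set _|; apply/setP => s; rewrite inE; apply/and3P/imsetP.
  case=> cs /eqP ks sf; have es : s = f @: (f @^-1: s).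
    apply/setP => x; apply/idP/imsetP => [xs|[y + ->]]; last by rewrite inE.
    by have /imsetP[y _ ey] := subsetP sf _ xs; exists y; rewrite ?inE -?ey.
  exists (f @^-1: s); rewrite // !inE -(clique_imset _ f_inj fE) -es cs /=.
  by rewrite -(card_imset _ f_inj) -es ks.
case=> t; rewrite !inE => /andP[ct kt] ->.
by rewrite (clique_imset _ f_inj fE) card_imset // ct kt imsetS ?subsetT.
Qed.

Lemma card_cliques_in_clique (T : finType) (G : sgraph T) (A : {set T}) k :
  clique G A -> #|cliques_in G A k| = 'C(#|A|, k).
Proof.
move=> cA; rewrite -cards_draws; congr #|pred_of_set _|; apply/setP => s.
rewrite !inE andbCA andbC; case: eqP; rewrite ?andbF //= andbT => _.
by case sA: (s \subset A); rewrite ?andbF // (sub_clique sA).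
Qed.

Lemma nfaces_iso (T U : finType) (G : sgraph T) (H : sgraph U) (f : U -> T)
    (k : nat) :
  bijective f -> (forall x y, G (f x) (f y) = H x y) ->
  nfaces (clique_complex G) k = nfaces (clique_complex H) k.
Proof.
move=> f_bij fE; rewrite -(@card_cliques_in_copy _ _ G setT H).
  apply: eq_card => s.
  by rewrite !inE subsetT andbT.
exists f; split=> //; first exact: bij_inj.
by apply/setP => x; rewrite inE; case: f_bij => g _ gK; rewrite -(gK x) imset_f.
Qed.

(** * Faces of a graph with independent vertices attached *)

Section Attach.

Variables (T I : finType) (G : sgraph T) (N : I -> {set T}).
Let A := attach G N.
Let cone i (s : {set T}) : {set (T + I)%type} := inr i |: inl @: s.

Lemma clique_attach_base (s : {set T}) : clique A (inl @: s) = clique G s.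
Proof. by apply: clique_imset => // x y [->]. Qed.

Lemma clique_attach_cone i (s : {set T}) :
  clique A (cone i s) = clique G s && (s \subset N i).
Proof.
apply/idP/andP=> [cS|[cs /subsetP sN]].
  split; first by rewrite -clique_attach_base (sub_clique _ cS) ?subsetUr.
  apply/subsetP => x xs; have /forall_inP/(_ _ (setU11 _ _))/forall_inP := cS.
  by move/(_ (inl x)); apply; rewrite // inE imset_f ?orbT.
apply/forall_inP => x /setU1P[->|xs]; apply/forall_inP => y /setU1P[->|ys].
- by rewrite eqxx.
- by case/imsetP: ys => u us ->; exact: sN.
- by case/imsetP: xs => u us ->; exact: sN.
- by move: cs; rewrite -clique_attach_base => /forall_inP/(_ _ xs)/forall_inP/(_ _ ys).
Qed.

Lemma inr_notin_inl i (s : {set T}) : (inr i : T + I) \notin inl @: s.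
Proof. by apply/imsetP => -[]. Qed.

Lemma inl_preimset (S : {set (T + I)%type}) :
  (forall i, inr i \notin S) -> S = inl @: (inl @^-1: S).
Proof.
move=> nS; apply/setP => -[x|i]; last by rewrite (negPf (nS i)) (negPf (inr_notin_inl _ _)).
by rewrite mem_imset ?inE // => ? ? [].
Qed.

Lemma clique_attach_inr i j (S : {set (T + I)%type}) :
  clique A S -> inr i \in S -> inr j \in S -> i = j.
Proof.
move=> /forall_inP cS iS jS; have /forall_inP/(_ _ jS) := cS _ iS.
by rewrite implybF negbK => /eqP[].
Qed.

Lemma cone_preimset i (S : {set (T + I)%type}) :
  clique A S -> inr i \in S -> S = cone i (inl @^-1: S).
Proof.
move=> cS iS; rewrite -[LHS](setD1K iS); congr (_ |: _).
rewrite [LHS]inl_preimset; last first.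
  move=> j; rewrite !inE; apply/negP => /andP[/eqP ji jS].
  by apply: ji; rewrite (clique_attach_inr cS jS iS).
by congr (inl @: pred_of_set _); apply/setP => x; rewrite !inE.
Qed.

Lemma card_cone i s : #|cone i s| = #|s|.+1.
Proof. by rewrite cardsU1 inr_notin_inl card_imset // => ? ? []. Qed.

(** New vertices are pairwise non-adjacent, so a clique contains at most one of them; those through
    [i] are the cones over cliques inside [N i]. *)
Lemma nfaces_attach k :
  nfaces (clique_complex A) k.+1 =
  nfaces (clique_complex G) k.+1 + \sum_i #|cliques_in G (N i) k|.
Proof.
have inl_inj : injective (@inl T I) by move=> ? ? [].
pose X := [set S in clique_complex A | #|S| == k.+1].
pose B := [set S : {set (T + I)%type} | [exists i, inr i \in S]].
rewrite /nfaces -/X -(cardsID B X) addnC; congr (_ + _).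
  rewrite -(card_imset _ (imset_inj inl_inj)); congr #|pred_of_set _|.
  apply/setP => S; apply/idP/imsetP.
    rewrite !inE negb_exists => /andP[/forallP/inl_preimset eS /andP[cS kS]].
    exists (inl @^-1: S); rewrite // !inE -clique_attach_base -eS cS.
    by rewrite -(card_imset _ inl_inj) -eS kS.
  case=> s; rewrite !inE => /andP[cs ks] ->.
  rewrite clique_attach_base card_imset // cs ks !andbT negb_exists.
  by apply/forallP => i; exact: inr_notin_inl.
(* The inner sum is 1, as each such clique has exactly one new vertex; exchanging the sums then
   sorts the cliques by that vertex. *)
have -> : #|X :&: B| = \sum_(S in X :&: B) \sum_(i | inr i \in S) 1.
  rewrite -sum1_card; apply: eq_bigr => S; rewrite !inE.
  case/andP=> /andP[cS _] /existsP[i iS]; rewrite (big_pred1 i) // => j.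
  by apply/idP/eqP => [jS|-> //]; apply: clique_attach_inr cS jS iS.
rewrite (exchange_big_dep xpredT) //=; apply: eq_bigr => i _; rewrite sum1dep_card.
have cone_inj : injective (cone i).
  move=> s t est; apply/setP => x.
  have : (inl x \in cone i s) = (inl x \in cone i t) by rewrite est.
  by rewrite !inE !mem_imset.
rewrite -(card_imset _ cone_inj); congr #|pred_of_set _|; apply/setP => S.
apply/idP/imsetP.
  rewrite !inE => /andP[/andP[/andP[cS kS] _] iS]; have eS := cone_preimset cS iS.
  exists (inl @^-1: S); rewrite // inE; move: cS kS.
  by rewrite eS clique_attach_cone card_cone -eS eqSS => /andP[-> ->] ->.
case=> s; rewrite [s \in _]inE => /and3P[cs ks sN] ->.
rewrite !inE clique_attach_cone card_cone cs sN eqSS ks eqxx /= andbT.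
by apply/existsP; exists i; rewrite setU11.
Qed.

End Attach.

(** * Induced Turan subgraphs and the Pascal recurrence *)

(* The deleted class is that of [s] modulo [s + 1], which is a smallest one. *)
Lemma turan_copy_class n s :
  induces_copy (turan n s.+1) [set x : 'I_n | x %% s.+1 != s]
    (turan (n - n %/ s.+1) s).
Proof.
have en := divn_eq n s.+1; have ltn := ltn_pmod n (ltn0Sn s).
(* For [s = 0] the index type is empty, so division by zero never matters. *)
have fP (i : 'I_(n - n %/ s.+1)) :
    exists2 x, x < n & x = i %/ s * s.+1 + i %% s /\ i %% s < s.
  case: s en ltn i => [|s] en ltn i; first by case: i => i; rewrite divn1 subnn.
  exists (i %/ s.+1 * s.+2 + i %% s.+1); last by rewrite ltn_pmod.
  case: i => i /=; have := divn_eq i s.+1; have := ltn_pmod i (ltn0Sn s).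
  move: (i %/ _) (i %% _) (n %/ _) (n %% _) en ltn => q t Q u; nia.
(* The increasing enumeration of the numbers not congruent to [s]: blocks of length [s] are spread
   out to blocks of length [s.+1], and residues are kept. *)
pose g (i : 'I_(n - n %/ s.+1)) := i %/ s * s.+1 + i %% s.
have gP i : g i < n by case: (fP i) => x ltx [ex _]; rewrite /g -ex.
have gmod i : g i %% s.+1 = i %% s.
  by case: (fP i) => _ _ [_ lts]; rewrite /g modnMDl modn_small // ltnW.
have gdiv i : g i %/ s.+1 = i %/ s.
  case: (fP i) => _ _ [_ lts].
  by rewrite /g divnMDl // [X in _ + X]divn_small ?addn0 // ltnW.
exists (fun i => Ordinal (gP i)); split.
- move=> i j /(congr1 val) /= eij; apply: val_inj.
  by rewrite /= (divn_eq i s) (divn_eq j s) -!gmod -!gdiv eij.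
- apply/setP => x; rewrite inE; apply/imsetP/idP => [[i _ ->]|xs] /=.
    by rewrite gmod; case: (fP i) => _ _ [_]; rewrite ltn_neqAle => /andP[].
  have lts : x %% s.+1 < s by rewrite ltn_neqAle xs -ltnS ltn_pmod.
  have lti : x %/ s.+1 * s + x %% s.+1 < n - n %/ s.+1.
    have := ltn_ord x; have := divn_eq x s.+1.
    move: (x %/ _) (x %% _) (n %/ _) (n %% _) en ltn lts => q t Q u; nia.
  exists (Ordinal lti); rewrite ?inE //; apply: val_inj; rewrite /= /g /=.
  rewrite divnMDl ?(leq_ltn_trans _ lts) // [X in (_ + X) * _]divn_small // addn0.
  by rewrite modnMDl modn_small // -divn_eq.
- by move=> i j; rewrite /= /turan_rel /= !gmod.
Qed.

(** Parts are residue classes, so an initial segment of a Turan graph is again a Turan graph. *)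
Lemma turan_copy n n' s : n' <= n - n %/ s.+1 ->
  exists S, induces_copy (turan n s.+1) S (turan n' s).
Proof.
move=> le_n; case: (turan_copy_class n s) => f [f_inj _ fE].
exists [set f (widen_ord le_n i) | i in [set: 'I_n']].
exists (fun i => f (widen_ord le_n i)); split=> // x y /f_inj/(congr1 val)/= exy.
exact: val_inj.
Qed.

(** Vertex 0 is viewed as attached to the other [n], renumbered down by one. Its own part then
    becomes the class of [s], so its neighbourhood is the set of [turan_copy_class]. *)
Lemma tbin_pascal n k s :
  tbin n.+1 k.+1 s.+1 = tbin n k.+1 s.+1 + tbin (n - n %/ s.+1) k s.
Proof.
pose S := [set x : 'I_n | x %% s.+1 != s].
rewrite [tbin (n - _) _ _]/tbin -(card_cliques_in_copy _ (turan_copy_class n s)).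
pose A := attach (turan n s.+1) (fun _ : unit => S).
pose f (x : 'I_n + unit) := if x is inl y then lift ord0 y else ord0.
transitivity (nfaces (clique_complex A) k.+1); last first.
  by rewrite nfaces_attach (big_pred1 tt) //; case.
apply: (@nfaces_iso _ _ _ _ f).
  exists (fun x => if unlift ord0 x is Some y then inl y else inr tt).
    by case=> [x|[]] /=; rewrite ?liftK ?unlift_none.
  by move=> x; case: unliftP => [y|] ->.
have key (x : 'I_n) : (x.+1 %% s.+1 == 0) = (x %% s.+1 == s).
  rewrite -addn1 -modnDml addn1; have : x %% s.+1 <= s by rewrite -ltnS ltn_pmod.
  rewrite leq_eqVlt => /predU1P[->|lts]; first by rewrite modnn !eqxx.
  by rewrite modn_small // (ltn_eqF lts).
case=> [x|[]] [y|[]] /=; rewrite /turan_rel /= /bump /= ?add1n ?mod0n.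
- by rewrite -[x.+1]addn1 -[y.+1]addn1 eqn_modDr.
- by rewrite key inE.
- by rewrite eq_sym key inE.
- by [].
Qed.

Lemma tbin_gt0 n k r : k <= n -> k <= r -> 0 < tbin n k r.
Proof.
move=> le_kn le_kr; have [->|k_gt0] := posnP k.
  rewrite /tbin /nfaces card_gt0; apply/set0Pn; exists set0.
  by rewrite !inE cards0 eqxx andbT; apply/forall_inP => x; rewrite inE.
apply: leq_trans (tbin_mono k r le_kn).
by have := @tbin_unbounded k r 0; rewrite mul0n addn0 k_gt0; apply.
Qed.

(** The case [r = 0] must be excluded: residues mod 0 are all distinct, so [turan n 0] is
    complete. *)
Lemma tbin_gt_parts n k r : 0 < r < k -> tbin n k r = 0.
Proof.
case: r => // r lt_rk; elim: r k lt_rk n => [|r IH] [|[|k]] //= lt_rk n.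
  elim: n => [|n IHn]; first exact: tbin_small.
  (* With one part, the neighbourhood of vertex 0 is empty. *)
  by rewrite tbin_pascal IHn divn1 subnn tbin_small.
by elim: n => [|n IHn]; [exact: tbin_small | rewrite tbin_pascal IHn IH].
Qed.

Lemma tindex_unique k r m n : 0 < k <= r ->
  tbin n k r <= m < tbin n.+1 k r -> tindex k r m = n.
Proof.
move=> kr nP; have [n0 [_ n0_unique]] := tindex_exists_unique m kr.
by rewrite -(n0_unique _ nP) -(n0_unique _ (tindexP m kr)).
Qed.

Lemma tindex_mono k r : 0 < k <= r -> {homo tindex k r : m m' / m <= m'}.
Proof.
move=> kr m m' le_m; rewrite leqNgt; apply/negP => /(tbin_mono k r).
have /andP[le_t _] := tindexP m kr; have /andP[_ lt_t] := tindexP m' kr; lia.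
Qed.

Lemma tbin_tindex_gt0 k r m : 0 < k <= r -> 0 < m ->
  0 < tbin (tindex k r m) k r.
Proof.
move=> kr m_gt0; have /andP[_ le_kr] := kr; apply: tbin_gt0 => //.
rewrite leqNgt; apply/negP => /(tbin_mono k r) le_t.
by have /andP[_] := tindexP m kr; have := tbin_diag k r; lia.
Qed.

(** * The sequences of the construction and its face numbers *)

Section Construction.

Variables k r v : nat.
Hypothesis kr : 1 < k <= r.

Let kr0 : 0 < k <= r. Proof. by lia. Qed.
Let kr1 : 0 < k.-1 <= r.-1. Proof. by lia. Qed.

(** The choice of the index keeps the subtraction from truncating. *)
Lemma m_seqS i :
  m_seq k r v i = tbin (n_seq k r v i) k.-1 r.-1 + m_seq k r v i.+1.
Proof. by rewrite /= subnKC //; have /andP[] := tindexP (m_seq k r v i) kr1. Qed.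

Lemma m_seq_le i : m_seq k r v i <= m_seq k r v 0.
Proof. by elim: i => // i; apply: leq_trans; rewrite [leqRHS]m_seqS leq_addl. Qed.

Lemma stops_at_exists : exists z, stops_at k r v z.
Proof.
have ex : exists i, m_seq k r v i == 0.
  (* Each step subtracts a positive binomial until 0 is reached. *)
  suff le_m i : m_seq k r v i <= m_seq k r v 0 - i.
    by exists (m_seq k r v 0); have := le_m (m_seq k r v 0); rewrite subnn leqn0.
  elim: i => [|i IH]; first by rewrite subn0.
  have [m0|m_gt0] := posnP (m_seq k r v i); first by rewrite /= m0.
  have : 0 < tbin (n_seq k r v i) k.-1 r.-1 by apply: tbin_tindex_gt0.
  by have := m_seqS i; lia.
case: (ex_minnP ex) => z /eqP z0 minz; exists z; split=> // i lt_iz.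
by rewrite lt0n; apply: contraTN lt_iz => /minz; rewrite -leqNgt.
Qed.

Lemma sum_n_seq z : stops_at k r v z ->
  v = tbin (n_zero k r v) k r + \sum_(i < z) tbin (n_seq k r v i) k.-1 r.-1.
Proof.
case=> mz _; suff <- : m_seq k r v 0 = \sum_(i < z) tbin (n_seq k r v i) k.-1 r.-1.
  by rewrite /= subnKC //; have /andP[] := tindexP v kr0.
(* Adding the final zero as [m_seq k r v z] gives a telescoping identity valid for every [z]. *)
rewrite -[RHS]addn0 -[X in _ + X]mz; elim: z {mz} => [|z IH].
  by rewrite big_ord0.
by rewrite big_ord_recr -addnA -m_seqS.
Qed.

(** The recursion of [dnum] passes through the same remainders [m_seq]; their positivity before [z]
    allows it to be unfolded. *)
Lemma sum_n_seq_dnum p z : stops_at k r v z ->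
  dnum p r k (m_seq k r v 0) = \sum_(i < z) tbin (n_seq k r v i) p.-1 r.-1.
Proof.
case=> mz mpos; rewrite -[RHS]addn0 -[X in _ + X](dnum0 p r k) -[X in _ + dnum _ _ _ X]mz.
elim: z mpos {mz} => [|z IH] mpos; first by rewrite big_ord0.
rewrite big_ord_recr -addnA IH => [|i lt_iz]; last by rewrite mpos // ltnW.
by rewrite (dnum_rec _ kr (mpos z (leqnn _))).
Qed.

Lemma nfaces_first z (N : 'I_z -> {set 'I_(n_zero k r v)}) j :
  0 < j -> first_choice N ->
  nfaces (clique_complex (first_graph N)) j =
  tbin (n_zero k r v) j r + \sum_(i < z) tbin (n_seq k r v i) j.-1 r.-1.
Proof.
case: j => // j _ NP; rewrite nfaces_attach; congr (_ + _); apply: eq_bigr => i _.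
exact: card_cliques_in_copy.
Qed.

(** Any [j.-1] of the [p.-1] neighbours of a new vertex span a face with it. *)
Lemma nfaces_final p z q (N : 'I_z -> {set 'I_(n_zero k r v)})
    (M : 'I_q -> {set 'I_(n_zero k r v)}) j :
  0 < j -> second_choice p M ->
  nfaces (clique_complex (final_graph N M)) j =
  nfaces (clique_complex (first_graph N)) j + q * 'C(p.-1, j.-1).
Proof.
case: j => // j _ MP; rewrite nfaces_attach; congr (_ + _).
rewrite -[q in RHS]card_ord -sum_nat_const; apply: eq_bigr => i _.
have [cM <-] := MP i; rewrite card_cliques_in_clique ?clique_attach_base //.
by rewrite card_imset // => ? ? [].
Qed.

End Construction.

(** * Assembling the theorem *)

Lemma turan_has_clique n k r : k <= n -> k <= r ->
  exists S, clique (turan n r) S /\ #|S| = k.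
Proof.
move=> le_kn le_kr; have := tbin_gt0 le_kn le_kr; rewrite card_gt0.
by case/set0Pn => S; rewrite !inE => /andP[cS /eqP kS]; exists S.
Qed.

Lemma cdim_leq (T : finType) (D : {set {set T}}) r :
  (forall j, r < j -> nfaces D j = 0) -> (cdim D <= r%:Z - 1)%R.
Proof.
move=> D0; rewrite /cdim; suff : \max_(s in D) #|s| <= r by lia.
apply/bigmax_leqP => s sD; rewrite leqNgt; apply/negP => /D0/eqP.
by rewrite cards_eq0 => /eqP/setP/(_ s); rewrite !inE sD eqxx.
Qed.

(** Not failing means [w1 <= w]. The neighbourhoods are arbitrary admissible choices, and the
    existence clauses keep the universal ones from being vacuous. *)
Theorem theorem3p9 (r k p v w a b m : nat)
    (r_gt0 : 0 < r) (k_gt0 : 0 < k) (p_gt0 : 0 < p) (v_gt0 : 0 < v)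
    (w_gt0 : 0 < w) (le_kr : k <= r) (lt_pk : p < k)
    (def_v : v = tbin a k r + tbin b k.-1 r.-1 + m)
    (lt_b : b < a - a %/ r)
    (lt_m : m < tbin (b - b %/ r.-1) k.-2 r.-2)
    (le_w : tbin a p r + tbin b p.-1 r.-1 + dnum p r k m <= w) :
  exists2 z : nat, stops_at k r v z &
    (exists N : 'I_z -> {set 'I_(n_zero k r v)}, first_choice N) /\
    (forall N : 'I_z -> {set 'I_(n_zero k r v)}, first_choice N ->
      let w1 := nfaces (clique_complex (first_graph N)) p in
      [/\ w1 <= w,
          exists M : 'I_(w - w1) -> {set 'I_(n_zero k r v)}, second_choice p M
        & forall M : 'I_(w - w1) -> {set 'I_(n_zero k r v)},
            second_choice p M ->
            let D := clique_complex (final_graph N M) in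
            [/\ is_flag_complex D, (cdim D <= r%:Z - 1)%R,
                nfaces D k = v & nfaces D p = w]]).
Proof.
have kr : 1 < k <= r by lia.
have kr0 : 0 < k <= r by lia.
have kr1 : 0 < k.-1 <= r.-1 by lia.
have pascal n l s : 0 < s -> 0 < l ->
    tbin n.+1 l s = tbin n l s + tbin (n - n %/ s) l.-1 s.-1.
  by case: s l => // s [|l] // _ _; exact: tbin_pascal.
(* By Pascal, the bound on [m] is the upper bound defining [b] as an index. *)
have lt_m0 : tbin b k.-1 r.-1 + m < tbin b.+1 k.-1 r.-1.
  by rewrite pascal ?ltn_add2l //; lia.
have n0E : n_zero k r v = a.
  apply: tindex_unique => //; rewrite def_v -addnA leq_addr pascal // ltn_add2l.
  exact: leq_trans lt_m0 (tbin_mono _ _ lt_b).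
have m0E : m_seq k r v 0 = tbin b k.-1 r.-1 + m by rewrite /= n0E; lia.
have jE : jidx k r (m_seq k r v 0) = b.
  by apply: tindex_unique; rewrite // m0E leq_addr.
(* The binomial above [m] is nonzero. Hence [p.-1 <= k.-2 <= b < a], which leaves room for the
   cliques of the second stage. *)
have le_k2b : k.-2 <= b.
  rewrite leqNgt; apply/negP => lt_bk; move: lt_m.
  by rewrite tbin_small // (leq_ltn_trans (leq_subr _ _)).
have [z zP] := stops_at_exists v kr; exists z => //; split.
  suff /fin_all_exists[N NP] (i : 'I_z) : exists S,
      induces_copy (turan (n_zero k r v) r) S (turan (n_seq k r v i) r.-1).
    by exists N.
  have -> : turan (n_zero k r v) r = turan (n_zero k r v) r.-1.+1.
    by rewrite prednK.
  apply: turan_copy; rewrite prednK // n0E.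
  (* The remainders never exceed the first one, so no later index exceeds [b]. *)
  have : n_seq k r v i <= b by rewrite -jE; apply: tindex_mono => //; apply: m_seq_le.
  by move/leq_trans; apply; exact: ltnW.
move=> N NP.
have w1E : nfaces (clique_complex (first_graph N)) p =
    tbin a p r + dnum p r k (m_seq k r v 0).
  by rewrite nfaces_first // n0E (sum_n_seq_dnum kr p zP).
move=> w1; have le_w1 : w1 <= w.
  apply: leq_trans le_w; rewrite /w1 w1E -addnA leq_add2l.
  (* If the construction stops at once, only an inequality remains, as [tbin b p.-1 r.-1] may still
     be positive; otherwise the first step of [dnum] removes [b] and leaves [m]. *)
  have [->|m0_gt0] := posnP (m_seq k r v 0); first by rewrite dnum0.
  by rewrite (dnum_rec p kr m0_gt0) jE m0E addKn.
split=> //.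
  have [||S [cS kS]] := @turan_has_clique (n_zero k r v) p.-1 r; [|lia|].
    by rewrite n0E; have := leq_subr (a %/ r) a; lia.
  by exists (fun=> S).
move=> M MP; split; first by exists (final_graph N M).
- apply: cdim_leq => j lt_rj; have j_gt0 : 0 < j by apply: leq_ltn_trans lt_rj.
  (* All three contributions vanish: [j > r], [j.-1 > r.-1] and [j.-1 > p.-1]. *)
  rewrite (nfaces_final _ j_gt0 MP) nfaces_first // tbin_gt_parts ?r_gt0 //.
  rewrite bin_small ?muln0 ?addn0; last by lia.
  by rewrite big1 // => i _; rewrite tbin_gt_parts //; lia.
- rewrite (nfaces_final _ k_gt0 MP) nfaces_first // bin_small; last by lia.
  by rewrite muln0 addn0 -sum_n_seq.
- by rewrite (nfaces_final _ p_gt0 MP) binn muln1 subnKC.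
Qed.
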